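(* Let $t_0$ be a (quantum) seed with $\tilde B(t_0)$ of full rank and let $F\subset I_{\mathrm{uf}}$. Assume that $\mathcal U(t_0)$ has a $\Bbbk$-basis $\mathcal Z=\{z_g\mid g\in\mathbb Z^I\}$ with each $z_g$ being $g$-pointed and such that $\{\mathfrak f_{F,g}z_g\mid g\in\mathbb Z^I\}$ is a $\Bbbk$-basis of $\mathcal U(\mathfrak f_Ft_0)$. Let $\mathcal S=\{s_g\mid g\in\mathbb Z^I\}$ be a $\Bbbk$-basis of $\mathcal U(t_0)$ such that each $s_g$ is $g$-pointed. Assume that $\mathcal S$ has Property (S), and that $\mathfrak f_F\mathcal S:=\{\mathfrak f_{F,g}s_g\mid g\in\mathbb Z^I\}$ has the factorization property in the direction $F$. Let $\mathcal S'=\{s'_g\mid g\in\mathbb Z^I\}$ be the set of localized functions, defined by $s'_g=s_g$ if $\mathrm{supp}\,s_g\cap F=\emptyset$, and otherwise $$s'_g=x^{-\sum_{j\in F}d_jf_j}\cdot s_{g+\sum_{j\in F}d_jf_j}$$ for a choice of sufficiently large $d_j=d_j(g)\in\mathbb N$, $j\in F$, such that $\mathrm{supp}\,s_{g+\sum_{j\in F}d_jf_j}\cap F=\emptyset$. Then $\mathcal S'$ is a $\Bbbk$-basis of $\mathcal U(\mathfrak f_Ft_0)$, and it equals $\mathfrak f_F\mathcal S$.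
   Context: Base ring: in the classical case $\Bbbk=\mathbb Z$ and $v=1$; in the quantum case $\Bbbk=\mathbb Z[v^{\pm1}]$ with $v$ an indeterminate. $\mathbb N=\{0,1,2,\dots\}$, $[a]_+=\max(a,0)$. Seeds. A seed $t$ consists of a finite set $I=I_{\mathrm{uf}}\sqcup I_{\mathrm f}$ (unfrozen and frozen vertices), positive integers $(d_i)_{i\in I}$, a rational matrix $(b_{ij})_{i,j\in I}$ with $d_i^\vee b_{ij}=-d_j^\vee b_{ji}$ (where $d_i^\vee=\mathrm{lcm}(d_j)_{j\in I}/d_i$) and $b_{ij}\in\mathbb Z$ whenever $i\in I_{\mathrm{uf}}$ or $j\in I_{\mathrm{uf}}$, and indeterminates $(x_i)_{i\in I}$. (These $d_i$ are unrelated to the exponents $d_j(g)$ in the claim.) Put $\tilde B=(b_{ik})_{i\in I,k\in I_{\mathrm{uf}}}$. Let $f_i$ ($i\in I$), $e_k$ ($k\in I_{\mathrm{uf}}$) be the unit vectors of $\mathbb Z^I$, $\mathbb Z^{I_{\mathrm{uf}}}$, and $p^*:\mathbb Z^{I_{\mathrm{uf}}}\to\mathbb Z^I$ the linear map $p^*e_k=\sum_i b_{ik}f_i$ (injective if $\tilde B$ has full rank). A quantum seed is a seed with a $\mathbb Z$-valued skew-symmetric bilinear form $\lambda$ on $\mathbb Z^I$ such that $\lambda(f_i,p^*e_k)=\delta_{ik}\mathbf d_k$ for some strictly positive integers $\mathbf d_k$. Laurent polynomials. $\mathcal{LP}(t)=\bigoplus_{m\in\mathbb Z^I}\Bbbk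 x^m$ with $x_i=x^{f_i}$ has a commutative product $x^g\cdot x^h=x^{g+h}$ and the twisted product $x^g*x^h=v^{\lambda(g,h)}x^{g+h}$ (they coincide in the classical case); its multiplication is $*$. Mutation at $k\in I_{\mathrm{uf}}$: $t'=\mu_kt$ has the same $I,I_{\mathrm{uf}},d_i$; $b'_{ij}=-b_{ij}$ if $k\in\{i,j\}$, and $b'_{ij}=b_{ij}+[b_{ik}]_+[b_{kj}]_+-[-b_{ik}]_+[-b_{kj}]_+$ otherwise; $x'_i=x_i$ for $i\ne k$ and $x_k'=x^{-f_k+\sum_i[b_{ik}]_+f_i}+x^{-f_k+\sum_i[-b_{ik}]_+f_i}$; in the quantum case $\lambda'(f_i,f_j)=\lambda(g_i,g_j)$ with $g_i=f_i$ for $i\neq k$ and $g_k=-f_k+\sum_i[-b_{ik}]_+f_i$. The (skew-)fields of fractions of $\mathcal{LP}(t')$ and $\mathcal{LP}(t)$ are identified accordingly. $\Delta^+_{t_0}$ is the set of all seeds obtained from $t_0$ by finite sequences of mutations at unfrozen vertices. The upper cluster algebra is $\mathcal U(t_0)=\bigcap_{t\in\Delta_{t_0}^+}\mathcal{LP}(t)$. Pointedness and support. $z\in\mathcal{LP}(t_0)$ is $g$-pointed ($g\in\mathbb Z^I$) if $z=\sum_{n\in\mathbb N^{I_{\mathrm{uf}}}}c_nx^{g+p^*n}$ with $c_n\in\Bbbk$, $c_0=1$. Then $\mathrm{supp}\,z=\bigcup_{c_n\neq0}\mathrm{supp}\,n$, where $\mathrm{supp}\,n=\{k\in I_{\mathrm{uf}}:n_k\ne0\}$.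 Freezing. $\mathfrak f_Ft_0$ is the seed with the same data as $t_0$ (the same $\lambda$ in the quantum case), except that its set of unfrozen vertices is $I_{\mathrm{uf}}\setminus F$ and its set of frozen vertices is $I_{\mathrm f}\sqcup F$; as algebras $\mathcal{LP}(\mathfrak f_Ft_0)=\mathcal{LP}(t_0)$. The freezing operator $\mathfrak f_{F,g}$ sends $\sum_{n\in\mathbb N^{I_{\mathrm{uf}}}}c_nx^{g+p^*n}$ to $\sum_{n:\ \mathrm{supp}\,n\cap F=\emptyset}c_nx^{g+p^*n}$. Property (S) for $\mathcal S$: for any $g$ and any $k\in I_{\mathrm{uf}}$, one has $k\notin\mathrm{supp}\,s_{g+df_k}$ whenever $d\in\mathbb N$ is large enough. Factorization property of a family $\{u_g\}_{g\in\mathbb Z^I}$ of $g$-pointed elements in the direction $F$: $v^{-\lambda(f_j,g)}x_j*u_g=u_{g+f_j}$ for all $g\in\mathbb Z^I$ and $j\in F$. *)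

(* Defs.v *)
From HB Require Import structures.
From mathcomp Require Import all_boot all_order all_algebra finmap.
From mathcomp.multinomials Require Export monalg.
From mathcomp.classical Require Import boolp.

Set Implicit Arguments.
Unset Strict Implicit.
Unset Printing Implicit Defensive.

Import Order.TTheory GRing.Theory Num.Theory.

Local Open Scope fset_scope.
Local Open Scope ring_scope.

Record bichar (R : comNzRingType) (G : zmodType) := Bichar {
  bichar_fun :> G -> G -> R;
  bichar0l : forall h, bichar_fun 0 h = 1;
  bichar0r : forall g, bichar_fun g 0 = 1;
  bicharDl : forall g g' h,
    bichar_fun (g + g') h = bichar_fun g h * bichar_fun g' h;
  bicharDr : forall g h h',
    bichar_fun g (h + h') = bichar_fun g h * bichar_fun g h' }.

Definition bichar1 (R : comNzRingType) (G : zmodType) : bichar R G.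
Proof. by exists (fun _ _ => 1) => *; rewrite ?mulr1. Defined.

(* The free R-module on x^g (g in G), with x^g * x^h = chi(g, h) x^(g + h). *)
Definition twalg (R : comNzRingType) (G : zmodType) (chi : bichar R G) : Type :=
  {malg R[G]}.

Section TwistedAlgebra.
Context (R : comNzRingType) (G : zmodType) (chi : bichar R G).

HB.instance Definition _ := GRing.Lmodule.on (twalg chi).

Implicit Types a b c : {malg R[G]}.

Definition twmul a b : {malg R[G]} :=
  \sum_(g <- msupp a) \sum_(h <- msupp b)
    << a@_g * b@_h * chi g h *g g + h >>.

Lemma twmulw (d1 d2 : {fset G}) a b :
  msupp a `<=` d1 -> msupp b `<=` d2 ->
  twmul a b = \sum_(g <- d1) \sum_(h <- d2) << a@_g * b@_h * chi g h *g g + h >>.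
Proof.
move=> le_d1 le_d2; rewrite /twmul (big_fset_incl _ le_d1) /=.
  apply/eq_bigr=> k1 _; apply/big_fset_incl => // k _ /mcoeff_outdom ->.
  by rewrite mulr0 mul0r monalgU0.
move=> k _ /mcoeff_outdom ak.
by rewrite big1 => // k' _; rewrite ak !mul0r monalgU0.
Qed.

Lemma twmulUU (x y : R) (g h : G) :
  twmul << x *g g >> << y *g h >> = << x * y * chi g h *g g + h >>.
Proof. by rewrite (twmulw msuppU_le msuppU_le) !big_seq_fset1 !mcoeffUU. Qed.

Lemma twmulDl : left_distributive twmul +%R.
Proof.
move=> a b c.
rewrite [twmul a c](twmulw (fsubsetUl _ (msupp b)) (fsubset_refl _)).
rewrite [twmul b c](twmulw (fsubsetUr (msupp a) _) (fsubset_refl _)).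
rewrite (twmulw (msuppD_le _ _) (fsubset_refl _)).
rewrite -big_split /=; apply/eq_bigr=> k1 _.
rewrite -big_split /=; apply/eq_bigr=> k2 _.
by rewrite mcoeffD !mulrDl monalgUD.
Qed.

Lemma twmulDr : right_distributive twmul +%R.
Proof.
move=> c a b.
rewrite [twmul c a](twmulw (fsubset_refl _) (fsubsetUl _ (msupp b))).
rewrite [twmul c b](twmulw (fsubset_refl _) (fsubsetUr (msupp a) _)).
rewrite (twmulw (fsubset_refl _) (msuppD_le _ _)).
rewrite -big_split /=; apply/eq_bigr=> k1 _.
rewrite -big_split /=; apply/eq_bigr=> k2 _.
by rewrite mcoeffD mulrDr !mulrDl monalgUD.
Qed.

Lemma twmul0l : left_zero 0 twmul.
Proof. by move=> a; rewrite /twmul msupp0 big_seq_fset0. Qed.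

Lemma twmul0r : right_zero 0 twmul.
Proof. by move=> a; rewrite /twmul big1 // => g _; rewrite msupp0 big_seq_fset0. Qed.

Lemma twmul_suml (J : Type) (r : seq J) (E : J -> {malg R[G]}) b :
  twmul (\sum_(j <- r) E j) b = \sum_(j <- r) twmul (E j) b.
Proof. exact: (big_morph (twmul^~ b) (fun _ _ => twmulDl _ _ _) (twmul0l b)). Qed.

Lemma twmul_sumr (J : Type) (r : seq J) (E : J -> {malg R[G]}) a :
  twmul a (\sum_(j <- r) E j) = \sum_(j <- r) twmul a (E j).
Proof. exact: (big_morph (twmul a) (fun _ _ => twmulDr _ _ _) (twmul0r a)). Qed.

Lemma twmul1l : left_id << 0 >> twmul.
Proof.
move=> a; rewrite [in LHS](monalgE a) twmul_sumr [RHS](monalgE a).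
by apply/eq_bigr=> g _; rewrite twmulUU bichar0l mul1r mulr1 add0r.
Qed.

Lemma twmul1r : right_id << 0 >> twmul.
Proof.
move=> a; rewrite [in LHS](monalgE a) twmul_suml [RHS](monalgE a).
by apply/eq_bigr=> g _; rewrite twmulUU bichar0r !mulr1 addr0.
Qed.

Lemma twmulA : associative twmul.
Proof.
move=> a b c.
rewrite (monalgE a) !twmul_suml; apply/eq_bigr=> g _.
rewrite (monalgE b) !(twmul_suml, twmul_sumr); apply/eq_bigr=> h _.
rewrite (monalgE c) !twmul_sumr; apply/eq_bigr=> k _.
rewrite !twmulUU addrA bicharDl bicharDr; congr (mkmalgU _ _).
by rewrite -!mulrA (mulrCA (chi h k)) (mulrCA c@_k) (mulrC (chi h k)).
Qed.

Lemma twone_neq0 : << 0 >> != 0 :> {malg R[G]}.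
Proof. by rewrite monalgU_eq0 oner_eq0. Qed.

HB.instance Definition _ := GRing.Zmodule_isNzRing.Build (twalg chi)
  twmulA twmul1l twmul1r twmulDl twmulDr twone_neq0.

Lemma twscaleAl (x : R) (a b : twalg chi) : x *: (a * b) = (x *: a) * b.
Proof.
rewrite -[x *: (a * b)]/(x *: twmul a b) -[RHS]/(twmul (x *: a) b).
rewrite (twmulw (msuppZ_le _ _) (fsubset_refl _)) /twmul scaler_sumr.
apply/eq_bigr=> g _; rewrite scaler_sumr; apply/eq_bigr=> h _.
by apply/malgP=> k; rewrite !mcoeffsE -!mulrnAr !mulrA.
Qed.

Lemma twscaleAr (x : R) (a b : twalg chi) : x *: (a * b) = a * (x *: b).
Proof.
rewrite -[x *: (a * b)]/(x *: twmul a b) -[RHS]/(twmul a (x *: b)).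
rewrite (twmulw (fsubset_refl _) (msuppZ_le _ _)) /twmul scaler_sumr.
apply/eq_bigr=> g _; rewrite scaler_sumr; apply/eq_bigr=> h _.
by apply/malgP=> k; rewrite !mcoeffsE -!mulrnAr !mulrA [a@_g * x]mulrC.
Qed.

HB.instance Definition _ := GRing.Lmodule_isLalgebra.Build R (twalg chi) twscaleAl.
HB.instance Definition _ := GRing.Lalgebra_isAlgebra.Build R (twalg chi) twscaleAr.

End TwistedAlgebra.

(* Z[v, v^-1], as the group ring of Z: v^n is << n >>. *)
Definition zlaurent : Type := twalg (bichar1 int int).

HB.instance Definition _ := GRing.NzRing.on zlaurent.

Lemma zlaurent_mulC : commutative (@GRing.mul zlaurent).
Proof.
move=> a b; rewrite -[a * b]/(twmul _ a b) -[b * a]/(twmul _ b a) /twmul exchange_big.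
apply/eq_bigr=> g _; apply/eq_bigr=> h _.
by rewrite addrC [a@_h * _]mulrC.
Qed.

HB.instance Definition _ :=
  GRing.PzRing_hasCommutativeMul.Build zlaurent zlaurent_mulC.

Variant flavour := Classical | Quantum.

Definition base (q : flavour) : comNzRingType :=
  match q with Classical => int | Quantum => zlaurent end.

Definition vpow (q : flavour) : int -> base q :=
  match q with
  | Classical => fun=> 1
  | Quantum => fun n => (<< n >> : zlaurent)
  end.

Lemma vpow0 q : vpow q 0 = 1.
Proof. by case: q. Qed.

Lemma vpowD q m n : vpow q (m + n) = vpow q m * vpow q n.
Proof.
case: q => //=.
by rewrite -[RHS]/(twmul _ << m >> << n >>) twmulUU !mulr1.
Qed.

Notation lattice I := {ffun I -> int}.

(* lam i j = lambda(f_i, f_j).  A classical seed has no form; it is encoded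
   with lam = 0 (see valid_seed). *)
Record seed (I : finType) := Seed {
  uf : {set I};
  wt : I -> nat;
  exch : I -> I -> rat;
  lam : I -> I -> int }.

Section Seeds.
Variable I : finType.
Implicit Types (t : seed I) (g h m : lattice I).

Definition fvec (i : I) : lattice I := [ffun j => (j == i)%:Z].

Definition form t g h : int := \sum_i \sum_j g i * h j * lam t i j.

Definition dual_wt t i : nat := ((\big[lcmn/1]_(j : I) wt t j) %/ wt t i)%N.

Definition is_seed t : Prop :=
  [/\ forall i, (0 < wt t i)%N,
      forall i j,
        (dual_wt t i)%:R * exch t i j = - ((dual_wt t j)%:R * exch t j i)
    & forall i j, (i \in uf t) || (j \in uf t) -> exch t i j \is a Num.int].

(* The integer b_ij; used only when i or j is unfrozen, so that b_ij is an
   integer, hence its own numerator. *)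
Definition exchz t i j : int := numq (exch t i j).

Definition ufv t : finType := {k : I | k \in uf t}.

Definition pstar t (n : {ffun ufv t -> int}) : lattice I :=
  [ffun i => \sum_(k : ufv t) n k * exchz t i (val k)].

Definition evec t (k : ufv t) : {ffun ufv t -> int} := [ffun l => (l == k)%:Z].

Definition compatible t : Prop :=
  [/\ forall i j, lam t i j = - lam t j i
    & exists D : ufv t -> nat,
        (forall k, (0 < D k)%N) /\
        forall i k, form t (fvec i) (pstar (evec k)) =
                    if i == val k then (D k)%:Z else 0].

Definition valid_seed (q : flavour) t : Prop :=
  is_seed t /\
  match q with
  | Classical => forall i j, lam t i j = 0
  | Quantum => compatible t
  end.

Definition Btilde t : 'M[rat]_(#|I|, #|ufv t|) :=
  \matrix_(i, k) exch t (enum_val i) (val (enum_val k)).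

(* B~ has |I| rows and |I_uf| <= |I| columns: its maximal rank is |I_uf|. *)
Definition full_rank t : Prop := \rank (Btilde t) = #|ufv t|.

Definition freeze_seed (F : {set I}) t : seed I :=
  Seed (uf t :\: F) (wt t) (exch t) (lam t).

(* The exponents of the two monomials of x'_k. *)
Definition mut_pos t k : lattice I :=
  - fvec k + \sum_i fvec i *~ Num.max (exchz t i k) 0.
Definition mut_neg t k : lattice I :=
  - fvec k + \sum_i fvec i *~ Num.max (- exchz t i k) 0.

Definition mut_vec t k i : lattice I := if i == k then mut_neg t k else fvec i.

Definition mut_exch t k i j : rat :=
  if (i == k) || (j == k) then - exch t i j
  else exch t i j + Num.max (exch t i k) 0 * Num.max (exch t k j) 0
                  - Num.max (- exch t i k) 0 * Num.max (- exch t k j) 0.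

Definition mut_seed k t : seed I :=
  Seed (uf t) (wt t) (mut_exch t k)
       (fun i j => form t (mut_vec t k i) (mut_vec t k j)).

End Seeds.

Section LaurentPolynomials.
Variables (q : flavour) (I : finType).
Implicit Types (t : seed I) (g h m : lattice I).

Lemma form0l t h : form t 0 h = 0.
Proof. by rewrite /form big1 // => i _; rewrite big1 // => j _; rewrite ffunE !mul0r. Qed.

Lemma form0r t g : form t g 0 = 0.
Proof.
by rewrite /form big1 // => i _; rewrite big1 // => j _; rewrite ffunE mulr0 mul0r.
Qed.

Lemma formDl t g g' h : form t (g + g') h = form t g h + form t g' h.
Proof.
rewrite -big_split; apply/eq_bigr=> i _ /=; rewrite -big_split.
by apply/eq_bigr=> j _ /=; rewrite ffunE !mulrDl.
Qed.

Lemma formDr t g h h' : form t g (h + h') = form t g h + form t g h'.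
Proof.
rewrite -big_split; apply/eq_bigr=> i _ /=; rewrite -big_split.
by apply/eq_bigr=> j _ /=; rewrite ffunE mulrDr mulrDl.
Qed.

Definition vform t : bichar (base q) (lattice I).
Proof.
exists (fun g h => vpow q (form t g h)) => *.
- by rewrite form0l vpow0.
- by rewrite form0r vpow0.
- by rewrite formDl vpowD.
- by rewrite formDr vpowD.
Defined.

Definition LP t : Type := twalg (vform t).

HB.instance Definition _ t := GRing.Algebra.on (LP t).

Definition lmon t m : LP t := << m >>.

(* The product x^g . x^h = x^(g + h), whereas the ring product of LP t is the
   twisted one. *)
Definition lcmul t (a b : LP t) : LP t := twmul (bichar1 (base q) (lattice I)) a b.

Definition nvec t : choiceType := {ffun ufv t -> nat}.

Definition pstarn t (n : nvec t) : lattice I := pstar [ffun k => (n k)%:Z].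

Definition nsupp t (n : nvec t) : {set I} := [set val k | k : ufv t & n k != 0%N].

Definition pointed t g (z : LP t) : Prop :=
  exists c : {malg (base q)[nvec t]},
    z = \sum_(n <- msupp c) c@_n *: lmon t (g + pstarn n) /\ c@_[ffun=> 0%N] = 1.

(* When p* is injective, the coefficient c_n of a g-pointed z is the
   coefficient of x^(g + p* n) in z.  Both supp and freeze below depend on this. *)
Definition supp t g (z : LP t) : {set I} :=
  [set k | `[< exists n : nvec t, z@_(g + pstarn n) != 0 /\ k \in nsupp n >]].

Definition freeze t (F : {set I}) g (z : LP t) : LP t :=
  \sum_(m <- msupp z |
        `[< exists n : nvec t, m = g + pstarn n /\ [disjoint nsupp n & F] >])
    z@_m *: lmon t m.

Definition propertyS t (s : lattice I -> LP t) : Prop :=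
  forall g k, k \in uf t ->
    exists d0 : nat, forall d : nat, (d0 <= d)%N ->
      k \notin supp (g + fvec k *+ d) (s (g + fvec k *+ d)).

Definition factorization t (F : {set I}) (u : lattice I -> LP t) : Prop :=
  forall g j, j \in F ->
    vpow q (- form t (fvec j) g) *: (lmon t (fvec j) * u g) = u (g + fvec j).

Definition shift (F : {set I}) (d : I -> nat) : lattice I :=
  \sum_(j in F) fvec j *+ d j.

Definition localized t (F : {set I}) (s : lattice I -> LP t)
    (d : lattice I -> I -> nat) g : LP t :=
  if [disjoint supp g (s g) & F] then s g
  else lcmul (lmon t (- shift F (d g))) (s (g + shift F (d g))).

End LaurentPolynomials.

(* L, with iota : A -> L, is a skew field of (right) fractions of A. *)
Definition skew_fraction_field (A : nzRingType) (L : unitRingType) (iota : A -> L)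
    : Prop :=
  [/\ injective iota,
      forall x : L, x != 0 -> x \is a GRing.unit
    & forall x : L, exists a b : A, b != 0 /\ x = iota a / iota b].

Section UpperClusterAlgebra.
Variables (q : flavour) (I : finType) (L : unitAlgType (base q)).

(* The cluster variables of every seed are elements of one skew field L: this is
   how the fraction fields of the LP(t) are identified. *)
Record cluster := Cluster { cseed : seed I; cvar : I -> L }.

(* x^m for the twisted product: with I enumerated as i_1, .., i_r,
   x_(i_1)^(m_1) * .. * x_(i_r)^(m_r) = v^(sum_(a < b) m_a m_b lam_ab) x^m. *)
Definition cmon (t : cluster) (m : lattice I) : L :=
  vpow q (- \sum_(i : I) \sum_(j : I | (enum_rank i < enum_rank j)%N)
              m i * m j * lam (cseed t) i j)
    *: \prod_(i <- enum I) cvar t i ^ m i.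

Definition mutate (t : cluster) (k : I) : cluster :=
  Cluster (mut_seed k (cseed t))
    (fun i => if i == k
              then cmon t (mut_pos (cseed t) k) + cmon t (mut_neg (cseed t) k)
              else cvar t i).

(* The image of LP(t) in L. *)
Definition in_LP (t : cluster) (z : L) : Prop :=
  exists c : {malg (base q)[lattice I]}, z = \sum_(m <- msupp c) c@_m *: cmon t m.

Definition upper (t : cluster) (z : L) : Prop :=
  forall ks : seq I, all (mem (uf (cseed t))) ks -> in_LP (foldl mutate t ks) z.

Definition freeze_cluster (F : {set I}) (t : cluster) : cluster :=
  Cluster (freeze_seed F (cseed t)) (cvar t).

Definition initial (t : seed I) (iota : LP q t -> L) : cluster :=
  Cluster t (fun i => iota (lmon q t (fvec i))).

End UpperClusterAlgebra.

Definition is_basis (R : nzRingType) (V : lmodType R) (J : choiceType)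
    (U : V -> Prop) (e : J -> V) : Prop :=
  [/\ forall j, U (e j),
      forall c : {malg R[J]}, \sum_(j <- msupp c) c@_j *: e j = 0 -> c = 0
    & forall z, U z -> exists c : {malg R[J]}, z = \sum_(j <- msupp c) c@_j *: e j].

(* Main.v *)
From HB Require Import structures.
Require Import Defs.
From mathcomp Require Import all_boot all_order all_algebra finmap.
From mathcomp.classical Require Import classical_sets boolp.

Set Implicit Arguments.
Unset Strict Implicit.
Unset Printing Implicit Defensive.

Import GRing.Theory.

Local Open Scope ring_scope.

(** As [p*] is injective, [g <= g + p* n] is a partial order on [Z^I].  If [s_g]
    is a linear combination of the [z_h], comparing coefficients at the maximal
    [h] that occur shows that they all satisfy [h = g + p* n], and then
    [f_(F,g) z_h] is [f_(F,h) z_h] or [0] according to whether [n] avoids [F].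
    Thus freezing turns the expansions of [S] in [Z] and of [Z] in [S] into
    expansions of [f_F S] in [f_F Z] and conversely, and [f_F S] is a basis
    because [f_F Z] is; independence follows from the leading terms.
    Finally [lambda(f_j, p* n) = 0] when [j] is in [F] and [n] avoids [F], so
    the factorization property says that [f_F S] is stable under the commutative
    product by [x^(f_j)], whence [s'_g = f_(F,g) s_g] for every [g]. *)

(** * Linear combinations and spans *)

Section LinearCombinations.
Context (R : nzRingType) (V : lmodType R) (J : choiceType).
Implicit Types (e : J -> V) (c : {malg R[J]}).

Definition lincomb e c : V := \sum_(j <- msupp c) c@_j *: e j.

Lemma lincombEw e c (D : {fset J}) :
  (msupp c `<=` D)%fset -> lincomb e c = \sum_(j <- D) c@_j *: e j.
Proof.
move=> leD; apply: big_fset_incl => // j _ /mcoeff_outdom ->.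
by rewrite scale0r.
Qed.

Lemma lincomb_is_linear e : linear (lincomb e).
Proof.
move=> a c1 c2; pose D := (msupp c1 `|` msupp c2)%fset.
have le1 : (msupp c1 `<=` D)%fset by exact: fsubsetUl.
have le2 : (msupp c2 `<=` D)%fset by exact: fsubsetUr.
have le3 : (msupp (a *: c1 + c2) `<=` D)%fset.
  apply: fsubset_trans (msuppD_le _ _) _.
  by apply: fsetSU; exact: msuppZ_le.
rewrite (lincombEw _ le1) (lincombEw _ le2) (lincombEw _ le3) scaler_sumr.
rewrite -big_split /=; apply: eq_bigr => j _.
by rewrite mcoeffD mcoeffZ scalerDl scalerA.
Qed.

HB.instance Definition _ e :=
  GRing.isLinear.Build R {malg R[J]} V *:%R (lincomb e) (lincomb_is_linear e).

Lemma lincombU e j : lincomb e << j >> = e j.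
Proof.
by rewrite (lincombEw _ msuppU_le) big_seq_fset1 mcoeffUU scale1r.
Qed.

Definition span e (v : V) : Prop := exists c, v = lincomb e c.

Lemma span_gen e j : span e (e j).
Proof. by exists << j >>; rewrite lincombU. Qed.

Lemma span0 e : span e 0.
Proof. by exists 0; rewrite linear0. Qed.

Lemma spanP e a u v : span e u -> span e v -> span e (a *: u + v).
Proof. by move=> [c1 ->] [c2 ->]; exists (a *: c1 + c2); rewrite linearP. Qed.

End LinearCombinations.

Section Submodules.
Context (R : nzRingType) (V : lmodType R) (U : V -> Prop).

Lemma lincomb_closed (J : choiceType) (e : J -> V) (c : {malg R[J]}) :
  U 0 -> (forall a u v, U u -> U v -> U (a *: u + v)) ->
  (forall j, j \in msupp c -> U (e j)) -> U (lincomb e c).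
Proof.
move=> U0 UP Ue; rewrite /lincomb.
(* Induction over any list of elements of the support, since a tail of the support is no longer the
   support of [c]. *)
elim: {-2}(msupp c : seq J) (fun j (h : j \in (msupp c : seq J)) => h) => [|j r IH] sub.
  by rewrite big_nil.
rewrite big_cons; apply: UP.
  by apply: Ue; apply: sub; rewrite inE eqxx.
by apply: IH => k kr; apply: sub; rewrite inE kr orbT.
Qed.

End Submodules.

Lemma span_trans (R : nzRingType) (V : lmodType R) (J K : choiceType)
    (e : J -> V) (e' : K -> V) (c : {malg R[J]}) :
  (forall j, j \in msupp c -> span e' (e j)) -> span e' (lincomb e c).
Proof. by move=> h; apply: lincomb_closed h; [exact: span0 | exact: spanP]. Qed.

Lemma lincomb_linear (R : nzRingType) (V W : lmodType R) (J : choiceType)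
    (f : {linear V -> W}) (e : J -> V) (c : {malg R[J]}) :
  f (lincomb e c) = lincomb (f \o e) c.
Proof. by rewrite linear_sum; apply: eq_bigr => j _; rewrite linearZ. Qed.

(** * Injectivity of [p*] from the rank of [B~] *)

Section FullRank.
Context (I : finType) (t : seed I).
Hypotheses (seed_t : is_seed t) (rank_t : full_rank t).

(** Full column rank gives a rational left inverse [C] of [B~], and [B~] acts on integer vectors as
    [p*]. *)
Lemma pstar_inj : injective (@pstar I t).
Proof.
have [_ _ intB] := seed_t.
have /row_fullP [C CB] : row_full (Btilde t) by rewrite /row_full rank_t.
pose vec (n : {ffun ufv t -> int}) : 'cV[rat]_#|ufv t| :=
  \col_l (n (enum_val l))%:~R.
have vecE n : Btilde t *m vec n = \col_i (pstar n (enum_val i))%:~R.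
  apply/matrixP => i j; rewrite !mxE ffunE rmorph_sum /=.
  rewrite [RHS](reindex (@enum_val (ufv t) predT)) /=; last first.
    exact: (onW_bij _ (@enum_val_bij _)).
  apply: eq_bigr => l _; rewrite !mxE rmorphM /= mulrC; congr (_ * _).
  (* The column index is unfrozen, so the entry is an integer and [numq] loses nothing. *)
  rewrite /exchz numqK //; apply: intB.
  by rewrite (valP (enum_val l)) orbT.
move=> m n eqmn; apply/ffunP => k.
have : vec m = vec n.
  by rewrite -[LHS]mul1mx -[RHS]mul1mx -CB -!mulmxA !vecE eqmn.
by move/matrixP/(_ (enum_rank k) 0); rewrite !mxE enum_rankK => /intr_inj.
Qed.

Lemma pstarn_inj : injective (@pstarn I t).
Proof.
move=> m n /pstar_inj/ffunP eqmn; apply/ffunP => k.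
by have := eqmn k; rewrite !ffunE => -[].
Qed.

End FullRank.

(** * The dominance order on exponents *)

Section Dominance.
Context (I : finType) (t : seed I).
Implicit Types (g h m : lattice I) (n : nvec t).

Lemma pstarnD n n' :
  pstarn ([ffun k => (n k + n' k)%N] : nvec t) = pstarn n + pstarn n'.
Proof.
apply/ffunP => i; rewrite !ffunE -big_split /=.
by apply: eq_bigr => k _; rewrite !ffunE PoszD mulrDl.
Qed.

Lemma pstarn0 : pstarn ([ffun=> 0%N] : nvec t) = 0.
Proof.
by apply/ffunP => i; rewrite !ffunE big1 // => k _; rewrite !ffunE mul0r.
Qed.

Lemma disjoint_nsuppP n (F : {set I}) :
  reflect (forall k : ufv t, val k \in F -> n k = 0%N) [disjoint nsupp n & F].
Proof.
rewrite disjoint_subset; apply: (iffP fintype.subsetP) => [h k kF|h i /imsetP[k]].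
  apply/eqP; apply/negPn/negP => nk.
  have kn : val k \in nsupp n by apply/imsetP; exists k; rewrite ?inE.
  by have := h _ kn; rewrite !inE kF.
by rewrite !inE => nk ->; apply/negP => /h; apply/eqP.
Qed.

Lemma disjoint_nsuppD n n' (F : {set I}) :
  [disjoint nsupp ([ffun k => (n k + n' k)%N] : nvec t) & F]
    = [disjoint nsupp n & F] && [disjoint nsupp n' & F].
Proof.
apply/disjoint_nsuppP/andP => [h|[/disjoint_nsuppP h /disjoint_nsuppP h'] k kF].
  by split; apply/disjoint_nsuppP => k /h; rewrite ffunE; case: (n k) (n' k) => [|?] [|?].
by rewrite ffunE h // h'.
Qed.

Definition dominates g h : Prop := exists n : nvec t, h = g + pstarn n.

Lemma dominates_refl g : dominates g g.
Proof. by exists [ffun=> 0%N]; rewrite pstarn0 addr0. Qed.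

Lemma dominates_trans h g m : dominates g h -> dominates h m -> dominates g m.
Proof.
move=> [n ->] [n' ->]; exists [ffun k => (n k + n' k)%N].
by rewrite pstarnD addrA.
Qed.

Hypothesis pinj : injective (@pstarn I t).

(** A cycle gives [p* (n + n') = 0], so [n + n' = 0], and natural numbers with zero sum vanish. *)
Lemma dominates_antisym g h : dominates g h -> dominates h g -> g = h.
Proof.
move=> [n ->] [n']; rewrite -addrA -pstarnD => /eqP.
rewrite -[X in X == _]addr0 -pstarn0 => /eqP/addrI/pinj/ffunP eqn.
suff -> : n = [ffun=> 0%N] by rewrite pstarn0 addr0.
by apply/ffunP => k; have := eqn k; rewrite !ffunE; case: (n k).
Qed.

(* The element dominated by the fewest members of [D] among those of [D]
   dominating [h] is dominated by itself only. *)
Lemma maximal_above (D : {fset lattice I}) h : h \in D ->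
  exists2 h', h' \in D & dominates h' h /\
    forall g, g \in D -> dominates g h' -> g = h'.
Proof.
move=> hD; pose up x := [fset g in D | `[< dominates g x >]]%fset.
have upP g x : g \in D -> dominates g x -> (g \in up x).
  by move=> gD gx; rewrite !inE gD; apply/asboolP.
have [k] := ubnP #|` up h|%fset; elim: k h hD => // k IH h hD; rewrite ltnS => lek.
have [[g [gD gh neq]]|no] := pselect (exists g, [/\ g \in D, dominates g h & g <> h]).
  have [|h' h'D [h'g max]] := IH g gD.
    (* The count drops from [h] to [g]: whatever dominates [g] dominates [h], while [h] itself does
       not dominate [g]. *)
    apply: leq_trans lek; apply: fproper_ltn_card; rewrite fproperE.
    apply/andP; split.
      apply/fsubsetP => x; rewrite !inE => /andP[xD /asboolP xg].
      by rewrite xD; apply/asboolP; exact: dominates_trans xg gh.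
    apply/fsubsetPn; exists h; first by apply: upP => //; exact: dominates_refl.
    rewrite !inE hD; apply/asboolP => hg.
    by apply: neq; exact: dominates_antisym.
  by exists h' => //; split=> //; exact: dominates_trans h'g gh.
exists h => //; split=> [|g gD gh]; first exact: dominates_refl.
by apply: contrapT => neq; apply: no; exists g.
Qed.

End Dominance.

Lemma sum_delta (K : choiceType) (V : zmodType) (D : {fset K}) (E : K -> V) m :
  \sum_(k <- D) E k *+ (k == m) = E m *+ (m \in D).
Proof.
have [mD|mD] := boolP (m \in D); last first.
  by apply: big1_seq => k /andP[_ kD]; case: eqP => // eqk; rewrite -eqk kD in mD.
rewrite (bigD1_seq m) //= eqxx big1 ?addr0 // => k /negbTE neq.
by rewrite neq.
Qed.

(** * Leading terms and the freezing operators *)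

Section LeadingTerms.
Context (q : flavour) (I : finType) (t : seed I).
Hypothesis pinj : injective (@pstarn I t).
Implicit Types (g h m : lattice I) (w : LP q t) (e : lattice I -> LP q t).
Implicit Types (F : {set I}) (c : {malg (base q)[lattice I]}).

(** Pointedness read on coefficients, which avoids choosing the [c_n]. *)
Definition leading g w : Prop :=
  w@_g = 1 /\ forall m, w@_m != 0 -> dominates t g m.

Lemma coef_lincomb e c m :
  (lincomb e c)@_m = \sum_(g <- msupp c) c@_g * (e g)@_m.
Proof.
by rewrite /lincomb [LHS]raddf_sum; apply: eq_bigr => g _; rewrite [LHS]mcoeffZ.
Qed.

Lemma coef_lmon g m : (lmon q t g)@_m = (g == m)%:R.
Proof. exact: mcoeffU. Qed.

Lemma pointed_leading g w : pointed g w -> leading g w.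
Proof.
move=> [c [-> c0]].
have coefE m : (\sum_(n <- msupp c) c@_n *: lmon q t (g + pstarn n))@_m =
    \sum_(n <- msupp c) c@_n *+ (g + pstarn n == m).
  rewrite [LHS]raddf_sum; apply: eq_bigr => n _.
  by rewrite [LHS]mcoeffZ coef_lmon mulr_natr.
split=> [|m]; last first.
  rewrite coefE; apply: contra_neqP => no; rewrite big1 // => n _.
  by case: eqP => // eqm; case: no; exists n.
(* By injectivity of [p*], only [n = 0] contributes to [x^g]. *)
rewrite coefE (eq_bigr (fun n => c@_n *+ (n == [ffun=> 0%N]))) => [|n _].
  by rewrite sum_delta -mcoeff_neq0 c0 oner_eq0.
by rewrite -[X in _ == X]addr0 -(pstarn0 t) (inj_eq (addrI g)) (inj_eq pinj).
Qed.

(** Nothing cancels at a maximal [h'] of the support of [c]: if [x^h'] occurs in [e g], then [g]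
    dominates [h'], so [g = h']. *)
Lemma leading_lincomb e c h :
  (forall g, leading g (e g)) -> h \in msupp c ->
  exists2 h', dominates t h' h & (lincomb e c)@_h' != 0.
Proof.
move=> lead_e /(maximal_above pinj)[h' h'c [h'h max]]; exists h' => //.
rewrite coef_lincomb (bigD1_seq h') //= (lead_e h').1 mulr1.
rewrite big1_seq ?addr0 ?mcoeff_neq0 //.
move=> g /andP[neq gc].
have [-> | /(lead_e g).2/max] := eqVneq (e g)@_h' 0; first by rewrite mulr0.
by move=> /(_ gc) eqg; rewrite eqg eqxx in neq.
Qed.

Definition thawed F g m : Prop :=
  exists n : nvec t, m = g + pstarn n /\ [disjoint nsupp n & F].

Lemma thawed_refl F g : thawed F g g.
Proof.
exists [ffun=> 0%N]; rewrite pstarn0 addr0; split=> //.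
by apply/disjoint_nsuppP => k _; rewrite ffunE.
Qed.

Lemma coef_freeze F g w m :
  (freeze F g w)@_m = if `[< thawed F g m >] then w@_m else 0.
Proof.
rewrite /freeze [LHS]raddf_sum big_mkcond /=.
rewrite (eq_bigr (fun k => (if `[< thawed F g k >] then w@_k else 0) *+ (k == m))).
  rewrite sum_delta; case: ifP => _; last by rewrite mul0rn.
  by rewrite -mcoeff_neq0; case: eqP => [->|].
move=> k _; rewrite -/(thawed F g k); case: ifP => _; last by rewrite mul0rn.
by rewrite [LHS]mcoeffZ coef_lmon mulr_natr.
Qed.

Lemma freeze_is_linear F g : linear (@freeze q I t F g).
Proof.
move=> a u v; apply/malgP => m; rewrite coef_freeze.
rewrite [LHS](_ : _ = if `[< thawed F g m >] then a * u@_m + v@_m else 0); last first.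
  by case: ifP => // _; rewrite [LHS]mcoeffD [X in X + _]mcoeffZ.
rewrite [RHS]mcoeffD [X in _ = X + _]mcoeffZ !coef_freeze.
by case: ifP; rewrite ?mulr0 ?addr0.
Qed.

HB.instance Definition _ F g :=
  GRing.isLinear.Build (base q) (LP q t) (LP q t) *:%R (@freeze q I t F g)
    (freeze_is_linear F g).

Lemma freeze_leading F g w : leading g w -> leading g (freeze F g w).
Proof.
move=> [wg wdom]; split=> [|m]; rewrite coef_freeze.
  by rewrite (asboolT (thawed_refl F g)).
by case: ifP => [_ /wdom|_]; rewrite ?eqxx.
Qed.

(** An exponent [g + p* n] of [w] with [n] meeting [F] would put a vertex of [F] into [supp g w]. *)
Lemma freeze_disjoint F g w :
  leading g w -> [disjoint supp g w & F] -> freeze F g w = w.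
Proof.
move=> [_ wdom] disj; apply/malgP => m; rewrite coef_freeze.
have [->|wm] := eqVneq w@_m 0; first by rewrite if_same.
rewrite asboolT //; have [n eqm] := wdom m wm; exists n; split=> //.
rewrite -setI_eq0; apply/eqP/setP => i; rewrite !inE; apply/negP => /andP[iN iF].
have : i \in supp g w :&: F.
  by rewrite !inE iF andbT; apply/asboolP; exists n; rewrite -eqm.
by move: disj; rewrite -setI_eq0 => /eqP ->; rewrite inE.
Qed.

(* If [h = g + p* n], the exponents kept by [freeze F g] above [h] are those
   kept by [freeze F h] when [n] avoids [F], and none otherwise. *)
Lemma freeze_change_leading F g h w : leading h w -> dominates t g h ->
  freeze F g w = freeze F h w \/ freeze F g w = 0.
Proof.
move=> [_ wdom] [n eqh]; have [nF|nF] := boolP [disjoint nsupp n & F]; [left|right].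
- apply/malgP => m; rewrite !coef_freeze.
  have [->|/wdom[n' eqm]] := eqVneq w@_m 0; first by rewrite !if_same.
  (* Here [m = g + p* (n + n')]. By injectivity no other vector over [g] gives [m], and [n + n']
     avoids [F] iff both [n] and [n'] do. *)
  rewrite (_ : `[< thawed F g m >] = `[< thawed F h m >]) //.
  apply/asboolP/asboolP => -[n2 [eqm2 n2F]].
    exists n'; split=> //; move: eqm2; rewrite eqm eqh -addrA -pstarnD.
    by move=> /addrI/pinj eqn; move: n2F; rewrite -eqn disjoint_nsuppD => /andP[].
  exists [ffun k => (n k + n2 k)%N]; rewrite disjoint_nsuppD nF n2F pstarnD addrA -eqh.
  by [].
- apply/malgP => m; rewrite coef_freeze [RHS]mcoeff0.
  case: asboolP => // -[n2 [eqm2 n2F]].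
  apply/eqP/negPn/negP => /wdom[n' eqm]; move: eqm2; rewrite eqm eqh -addrA -pstarnD.
  by move=> /addrI/pinj eqn; move: n2F; rewrite -eqn disjoint_nsuppD (negbTE nF).
Qed.

Lemma freeze_lincomb F e c g :
  (forall h, leading h (e h)) -> leading g (lincomb e c) ->
  span (fun h => freeze F h (e h)) (freeze F g (lincomb e c)).
Proof.
move=> lead_e [_ dom_g]; rewrite lincomb_linear; apply: span_trans => h hc /=.
(* Some [h'] dominating [h] has a nonzero coefficient in the combination, so [g] dominates [h'] and
   hence [h]. *)
have [h' h'h /dom_g gh'] := leading_lincomb lead_e hc.
have [->|->] := freeze_change_leading F (lead_e h) (dominates_trans gh' h'h).
  exact: (span_gen (fun h => freeze F h (e h))).
exact: span0.
Qed.

Lemma leading_free e c : (forall g, leading g (e g)) -> lincomb e c = 0 -> c = 0.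
Proof.
move=> lead_e eq0; apply/malgP => h; rewrite [RHS]mcoeff0; apply/eqP.
rewrite mcoeff_eq0; apply/negP => /(leading_lincomb lead_e)[h' _].
by rewrite eq0 mcoeff0 eqxx.
Qed.

End LeadingTerms.

(** A general [chi] covers both the twisted and the commutative product by a monomial. *)
Lemma coef_twmulU (R : comNzRingType) (G : zmodType) (chi : bichar R G)
    (e : G) (a : {malg R[G]}) m :
  (twmul chi << e >> a)@_m = chi e (m - e) * a@_(m - e).
Proof.
rewrite (twmulw chi msuppU_le (fsubset_refl _)) big_seq_fset1 raddf_sum /=.
rewrite (eq_bigr (fun g => (a@_g * chi e g) *+ (g == m - e))) => [|g _]; last first.
  by rewrite mcoeffUU mul1r mcoeffU [g == _]eq_sym subr_eq addrC eq_sym.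
rewrite sum_delta -mcoeff_neq0 mulrC.
by case: eqP => [->|//]; rewrite mulr0.
Qed.

(** * Factorization and localized functions *)

Section Localization.
Context (q : flavour) (I : finType) (t : seed I) (F : {set I}).
Implicit Types (g h m : lattice I) (w : LP q t).

Lemma pstarn_sum (n : nvec t) :
  pstarn n = \sum_(k : ufv t) pstar (evec k) *+ n k.
Proof.
apply/ffunP => i; rewrite sum_ffunE ffunE; apply: eq_bigr => k _.
rewrite ffunMnE !ffunE (bigD1 k) //= !ffunE eqxx mul1r big1 => [|l /negbTE neq].
  by rewrite addr0 -mulr_natl natz.
by rewrite ffunE neq mul0r.
Qed.

(** By compatibility [lambda(f_j, p* e_k)] vanishes unless [j = k], and in that case [n k = 0]
    because [n] avoids [F]. *)
Lemma form_pstarn j (n : nvec t) :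
  compatible t -> j \in F -> [disjoint nsupp n & F] ->
  Defs.form t (fvec j) (pstarn n) = 0.
Proof.
move=> [_ [D [_ formE]]] jF /disjoint_nsuppP nF.
rewrite pstarn_sum (big_morph _ (Defs.formDr t (fvec j)) (Defs.form0r t (fvec j))).
apply: big1 => k _; have [jk|jk] := eqVneq j (val k).
  by rewrite (nF k) ?mulr0n ?Defs.form0r // -jk.
elim: (n k) => [|i IH]; first by rewrite mulr0n Defs.form0r.
by rewrite mulrSr Defs.formDr IH add0r formE (negbTE jk).
Qed.

(** Hence multiplication by [x_j] twists all terms kept by [freeze F g] by the same power of [v]. *)
Lemma vpow_thawed j g m : valid_seed q t -> j \in F -> thawed t F g m ->
  vpow q (Defs.form t (fvec j) m) = vpow q (Defs.form t (fvec j) g).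
Proof.
case: q => -[_ //= compat] jF [n [-> nF]].
by rewrite Defs.formDr form_pstarn ?addr0.
Qed.

(* [x^e . u g = u (g + e)], expressed on coefficients. *)
Definition translates (u : lattice I -> LP q t) (e : lattice I) : Prop :=
  forall g m, (u (g + e))@_(m + e) = (u g)@_m.

(** The property passes from [e] and [e'] to [e + e'], and [shift F d] is a sum of vectors [f_j]
    with [j] in [F]. *)
Lemma translates_shift u (d : I -> nat) :
  (forall j, j \in F -> translates u (fvec j)) -> translates u (shift F d).
Proof.
move=> trF; have tr0 : translates u 0 by move=> g m; rewrite !addr0.
have trD e e' : translates u e -> translates u e' -> translates u (e + e').
  by move=> h h' g m; rewrite !addrA h' h.
rewrite /shift; elim/big_ind: _ => // j /trF trj.
by elim: (d j) => [|k IH]; rewrite ?mulr0n // mulrSr; exact: trD.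
Qed.

Lemma freeze_translates (s : lattice I -> LP q t) j : valid_seed q t ->
  factorization F (fun g => freeze F g (s g)) -> j \in F ->
  translates (fun g => freeze F g (s g)) (fvec j).
Proof.
move=> valid fact jF g m; rewrite -(fact g j jF) [LHS]mcoeffZ.
rewrite [X in _ * X](coef_twmulU (vform q t)) addrK coef_freeze.
case: asboolP => [th|_]; last by rewrite !mulr0.
(* The normalising factor [v^(-lambda(f_j, g))] cancels the twist, which is [v^(lambda(f_j, g))] at
   every thawed [m]. *)
by rewrite /= (vpow_thawed valid jF th) mulrA -vpowD addNr vpow0 mul1r.
Qed.

Lemma localizedE (s : lattice I -> LP q t) (d : lattice I -> I -> nat) g :
  valid_seed q t ->
  (forall h, leading h (s h)) ->
  factorization F (fun g => freeze F g (s g)) ->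
  (~~ [disjoint supp g (s g) & F] ->
     [disjoint supp (g + shift F (d g)) (s (g + shift F (d g))) & F]) ->
  localized F s d g = freeze F g (s g).
Proof.
move=> valid lead_s fact disj; rewrite /localized; case: ifPn => [|/disj] sF.
  by rewrite freeze_disjoint.
apply/malgP => m.
rewrite [LHS](coef_twmulU (bichar1 _ _)) /= mul1r opprK.
rewrite -{1}(freeze_disjoint (lead_s _) sF).
apply: (translates_shift (u := fun g => freeze F g (s g))) => j jF.
exact: freeze_translates.
Qed.

End Localization.

(** * Bases of the upper cluster algebras *)

(** For each seed [in_LP] is by definition the [span] of the monomials [cmon], so [upper] is an
    intersection of submodules. *)
Lemma upper_span_closed (q : flavour) (I : finType) (L : unitAlgType (base q))
    (t : cluster I L) (J : choiceType) (e : J -> L) (c : {malg (base q)[J]}) :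
  (forall j, j \in msupp c -> upper t (e j)) -> upper t (lincomb e c).
Proof.
apply: lincomb_closed => [ks _|a u v uU vU ks uf_ks]; first exact: span0.
by apply: spanP; [exact: uU | exact: vU].
Qed.

(** Serves with [(u, e)] equal to [(s, z)] for membership and to [(z, s)] for generation.
    Injectivity of [iota] brings the expansion of [u g] from [L] back to [LP q t]. *)
Lemma freeze_basis_in_span (q : flavour) (I : finType) (t : seed I) (F : {set I})
    (L : unitAlgType (base q)) (iota : {lrmorphism LP q t -> L})
    (U : L -> Prop) (u e : lattice I -> LP q t) g :
  injective (@pstarn I t) -> injective iota ->
  (forall h, leading h (e h)) -> leading g (u g) ->
  is_basis U (fun h => iota (e h)) -> U (iota (u g)) ->
  span (fun h => iota (freeze F h (e h))) (iota (freeze F g (u g))).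
Proof.
move=> pinj iota_inj lead_e lead_u [_ _ gen_e] /gen_e[c].
rewrite -/(lincomb _ _) -(lincomb_linear iota e) => /iota_inj equ.
rewrite equ in lead_u *; have [c' ->] := freeze_lincomb pinj F lead_e lead_u.
by exists c'; rewrite lincomb_linear.
Qed.

Theorem theorem1p4 (q : flavour) (I : finType) (t0 : seed I) (F : {set I})
    (L : unitAlgType (base q)) (iota : {lrmorphism LP q t0 -> L})
    (z s : lattice I -> LP q t0) (d : lattice I -> I -> nat) :
  valid_seed q t0 ->
  full_rank t0 ->
  F \subset uf t0 ->
  skew_fraction_field iota ->
  is_basis (upper (initial iota)) (fun g => iota (z g)) ->
  (forall g, pointed g (z g)) ->
  is_basis (upper (freeze_cluster F (initial iota)))
    (fun g => iota (freeze F g (z g))) ->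
  is_basis (upper (initial iota)) (fun g => iota (s g)) ->
  (forall g, pointed g (s g)) ->
  propertyS s ->
  factorization F (fun g => freeze F g (s g)) ->
  (forall g, ~~ [disjoint supp g (s g) & F] ->
     [disjoint supp (g + shift F (d g)) (s (g + shift F (d g))) & F]) ->
  is_basis (upper (freeze_cluster F (initial iota)))
    (fun g => iota (localized F s d g)) /\
  range (localized F s d) = range (fun g => freeze F g (s g)).
Proof.
move=> valid rank_t0 _ [iota_inj _ _] basis_z point_z basis_fz basis_s point_s _ fact disj.
have pinj : injective (@pstarn I t0) by apply: pstarn_inj rank_t0; case: valid.
have lead_z g : leading g (z g) by exact: pointed_leading.
have lead_s g : leading g (s g) by exact: pointed_leading.
(* With pointwise equality the two ranges coincide, and the basis property is left to prove for
   [f_F S]. *)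
have -> : localized F s d = fun g => freeze F g (s g).
  by apply/funext => g; apply: localizedE => //; exact: disj.
split=> //; have [Uz _ _] := basis_z; have [Us _ _] := basis_s.
have [Ufz _ gen_fz] := basis_fz; split=> [g|c|x /gen_fz[c ->]].
- have [c ->] := freeze_basis_in_span F pinj iota_inj lead_z (lead_s g) basis_z (Us g).
  exact: upper_span_closed.
(* Independence is checked in [LP q t0], where freezing preserves leading terms. *)
- rewrite -/(lincomb _ _) -(lincomb_linear iota (fun g => freeze F g (s g))).
  rewrite -[RHS](linear0 iota) => /iota_inj; apply: leading_free => // g.
  exact: freeze_leading.
- apply: span_trans => g _.
  exact: (freeze_basis_in_span F pinj iota_inj lead_s (lead_z g) basis_s (Uz g)).
Qed.
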